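(* Consider the monochromatic Maker-Breaker game with bias $1:s$. For every $k,t\in\mathbb{N}$ and every constant $s\geq 1$, Maker can ensure that there are $t$ pairwise parallel $k$-strips with respect to the set of points placed by both players. When $s\in\mathbb{N}$, this can be accomplished in at most $t/(s+1)$ rounds for $k=1$ and at most $\left(\frac{(4s)^{k-2}}{s+1}+\frac{(4s)^{k-2}-1}{4s-1}\right)2t$ rounds for $k\geq 2$.
   Context: Monochromatic Maker-Breaker game with bias $1:s$: Maker and Breaker place points in the plane, Maker starting; in each round Maker places one point and Breaker places $s$ points (for noninteger speeds, the multiset $\{i\cdot 1:i\in\mathbb{N}\}\cup\{i\cdot s:i\in\mathbb{N}\}$ is ordered increasingly, ties broken in favor of Maker, and this order determines whose turn it is). At all times the set $S$ of all placed points must be in general position (no three collinear). Maker wins if at some time $S$ contains a $k$-hole. A $k$-hole of $S$ is a subset $H\subseteq S$ of size $k$ such that $\mathrm{conv}(H)$ is a convex $k$-gon and $\mathrm{conv}(H)\cap S=H$. For a nonzero vector $v$, $\vec v$ is the closed halfline from the origin in direction $v$; $A+B$ is the Minkowski sum. A $k$-strip with respect to $S$ is a set $P\subseteq S$ of $k$ points in convex position for which there is a halfline $\vec v$ such that $C=\mathrm{conv}(P)+\vec v$ satisfies $\mathrm{int}(C)\cap S=\emptyset$ and $\partial C\cap S=P$. Two $k$-strips $P_1,P_2$ are parallel if they are $k$-strips with respect to the same halfline $\vec v$ and $\mathrm{conv}(P_1)+\vec v$, $\mathrm{conv}(P_2)+\vec v$ are disjoint. *)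

(* Defs.v *)
From mathcomp Require Import all_boot all_order all_algebra finmap.
From mathcomp Require Import all_classical all_reals all_analysis.

Set Implicit Arguments.
Unset Strict Implicit.
Unset Printing Implicit Defensive.

Import Order.TTheory GRing.Theory Num.Theory.
Import numFieldNormedType.Exports.

Local Open Scope classical_set_scope.
Local Open Scope ring_scope.

Definition plane (R : realType) : normedModType R := 'rV[R]_2.

Section Geometry.
Context {R : realType}.
Implicit Types (a b c v : plane R) (A B S : set (plane R)).
Implicit Types (P : {fset plane R}) (h : seq (plane R)).

Definition collinear a b c : Prop :=
  exists p v, v != 0 /\ [set a; b; c] `<=` [set p + x *: v | x in [set: R]].

(* A position of the game is the list of the points placed so far, oldest
   first. [uniq] says that a move always places a new point. *)
Definition general_position h : Prop :=
  uniq h /\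
  forall a b c, a \in h -> b \in h -> c \in h ->
    a != b -> a != c -> b != c -> ~ collinear a b c.

Definition hull A : set (plane R) := smallest (@convex_set R (plane R)) A.

Definition halfline v : set (plane R) := [set x *: v | x in [set x : R | 0 <= x]].

Definition minkowski A B : set (plane R) := [set a + b | a in A & b in B].

Definition boundary A : set (plane R) := closure A `\` interior A.

Definition convex_position P : Prop :=
  forall p, p \in P -> ~ hull ([set` P] `\ p) p.

Definition strip_region P v : set (plane R) := minkowski (hull [set` P]) (halfline v).

Definition k_strip S (k : nat) v P : Prop :=
  [/\ [set` P] `<=` S, #|` P| = k & convex_position P] /\
  [/\ v != 0,
      interior (strip_region P v) `&` S = set0 &
      boundary (strip_region P v) `&` S = [set` P]].

Definition parallel S (k : nat) v P1 P2 : Prop :=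
  [/\ k_strip S k v P1, k_strip S k v P2 &
      strip_region P1 v `&` strip_region P2 v = set0].

(* The halfline is common to the whole family, and each member is required to
   be a strip on its own so that the case t = 1 is not vacuous. *)
Definition parallel_strips (k t : nat) h : Prop :=
  exists v (P : 'I_t -> {fset plane R}),
    (forall i, k_strip [set` h] k v (P i)) /\
    (forall i j, i != j -> parallel [set` h] k v (P i) (P j)).

End Geometry.

Section Game.
Context {R : realType}.
Implicit Types (s r : R) (goal : seq (plane R) -> Prop).

(* Numbers (i, j) of moves made by Maker and by Breaker among the first n moves:
   the next move of Maker is due at time i * s and that of Breaker at time j * 1
   (i, j counted from 0, so that Maker starts), and ties go to Maker. *)
Fixpoint moves s (n : nat) : nat * nat :=
  if n is m.+1 then
    let: (i, j) := moves s m in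
    if i%:R * s <= j%:R then (i.+1, j) else (i, j.+1)
  else (0%N, 0%N).

Definition maker_turn s (n : nat) : bool :=
  let: (i, j) := moves s n in i%:R * s <= j%:R.

Definition maker_strategy s (sigma : seq (plane R) -> plane R) : Prop :=
  forall h, general_position h -> maker_turn s (size h) ->
    general_position (rcons h (sigma h)).

Definition legal_play (x : nat -> plane R) : Prop :=
  forall n, general_position (mkseq x n).

Definition follows s (sigma : seq (plane R) -> plane R) (x : nat -> plane R) : Prop :=
  forall n, maker_turn s n -> x n = sigma (mkseq x n).

Definition maker_ensures s goal : Prop :=
  exists sigma, maker_strategy s sigma /\
    forall x, legal_play x -> follows s sigma x -> exists n, goal (mkseq x n).

(* For integer s a round consists of s + 1 moves; a partially played round
   counts proportionally, i.e. n moves make n / (s + 1) rounds. *)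
Definition rounds s (n : nat) : R := n%:R / (s + 1).

Definition maker_ensures_within s r goal : Prop :=
  maker_ensures s (fun h => goal h /\ rounds s (size h) <= r).

(* For integer bias, Maker's moves are exactly those that open a round. *)
Lemma maker_turn_nat (m n : nat) : maker_turn m%:R n = (m.+1 %| n)%N.
Proof.
have step i j : (i%:R * m%:R <= j%:R :> R) = (i * m <= j)%N by rewrite -natrM ler_nat.
have movesS n' : moves m%:R n'.+1 = let: (i, j) := moves m%:R n' in
    if i%:R * m%:R <= j%:R :> R then (i.+1, j) else (i, j.+1) by [].
have inround q b : moves m%:R (q * m.+1) = (q, q * m)%N -> (b <= m)%N ->
    moves m%:R (q * m.+1 + b).+1 = (q.+1, q * m + b)%N.
  move=> Hq; elim: b => [_|b IHb ltbm]; first by rewrite !addn0 movesS Hq step leqnn.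
  by rewrite movesS addnS IHb 1?ltnW// step mulSn addnC leq_add2l leqNgt ltbm addnS.
have start q : moves m%:R (q * m.+1) = (q, q * m)%N.
  elim: q => [|q IHq]; first by rewrite !mul0n.
  have -> : (q.+1 * m.+1)%N = (q * m.+1 + m).+1 by rewrite mulSn addnC addnS.
  by rewrite inround// mulSn addnC.
rewrite /maker_turn {1}(divn_eq n m.+1) /dvdn.
have := ltn_pmod n (ltn0Sn m); case: (n %% m.+1)%N => [_|b ltbm].
  by rewrite addn0 start step leqnn.
by rewrite addnS inround 1?ltnW// step mulSn addnC leq_add2l leqNgt -ltnS ltbm.
Qed.

End Game.

(* Main.v *)
(* Maker fixes a direction, taken vertical here, and looks at the chains obtained
   by adding points on the right. A point r to the right of an empty chain P
   extends it if r is the steepest one, seen from the last point of P, up to some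
   abscissa, and is above all the lines through two points of P; a very high point
   q just to the right of P ensures that such an r (possibly placed by Breaker)
   exists. As Breaker kills at most one chain with each of his points, Maker
   groups 4 s t disjoint chains into 2 t blocks of 2 s consecutive ones and spends
   2 t moves to put one high point right after each block. Breaker's 2 s t points
   can kill all the chains of at most t blocks; in each of the other blocks a
   surviving chain is extended. *)
Require Import Defs.
From mathcomp Require Import all_boot all_order all_algebra finmap.
From mathcomp Require Import all_classical all_reals all_analysis.
From mathcomp Require Import ring lra zify.

Import Order.TTheory GRing.Theory Num.Theory.
Import numFieldNormedType.Exports.

Local Open Scope classical_set_scope.
Local Open Scope ring_scope.

Set Implicit Arguments.
Unset Strict Implicit.
Unset Printing Implicit Defensive.

(** * Extremal and generic choices against finite lists of numbers *)

Lemma seq_argmax (R : realDomainType) (T : eqType) (f : T -> R) (s : seq T) :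
  s != [::] -> exists2 x, x \in s & forall y, y \in s -> f y <= f x.
Proof.
elim: s => // a s IHs _; have [->|/IHs[x xs xmax]] := eqVneq s [::].
  by exists a; rewrite ?mem_head// => y; rewrite inE => /eqP->.
have [le_xa|lt_ax] := leP (f x) (f a).
  exists a; first exact: mem_head.
  by move=> y; rewrite inE => /predU1P[->//|/xmax/le_trans]; apply.
exists x; first by rewrite inE xs orbT.
by move=> y; rewrite inE => /predU1P[->|/xmax//]; exact: ltW.
Qed.

(** Induction on the list: the upper end is lowered to [hi'] so that the head [a] falls outside the
    open interval from [lo] to [hi']. *)
Lemma seq_avoid_between (R : realFieldType) (s : seq R) (lo hi : R) :
  lo < hi -> exists2 x, x \notin s & lo < x < hi.
Proof.
elim: s hi => [|a s IHs] hi lt_lohi; first by exists ((lo + hi) / 2) => //; lra.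
have [hi' lt_lohi' /andP[hi'le hi'a]] :
    exists2 hi', lo < hi' & (hi' <= hi) && ((hi' <= a) || (a <= lo)).
  have [lt_loa|le_alo] := ltP lo a; last by exists hi; rewrite // lexx orbT.
  by exists (Num.min a hi); rewrite ?lt_min ?lt_loa// !ge_min !lexx orbT.
have [x xs /andP[lox xhi]] := IHs _ lt_lohi'; exists x.
  rewrite inE negb_or xs andbT; apply/eqP => xa.
  by case/orP: hi'a => ?; lra.
by rewrite lox (lt_le_trans xhi).
Qed.

(** Used in two ways: with [B] empty it picks a number beyond a finite list of bounds; with the
    abscissas on two sides of a gap it picks a fresh abscissa in the gap. *)
Lemma seq_avoid_gap (R : realFieldType) (A B s : seq R) :
  (forall a b, a \in A -> b \in B -> a < b) ->
  exists x, [/\ x \notin s, forall a, a \in A -> a < x & forall b, b \in B -> x < b].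
Proof.
move=> ltAB.
have [lo loA loB] : exists2 lo, forall a, a \in A -> a <= lo &
    forall b, b \in B -> lo < b.
  have [A0|/(@seq_argmax _ _ id)[a aA amax]] := eqVneq A [::]; last first.
    by exists a => // b; exact: ltAB.
  have [->|/(@seq_argmax _ _ -%R)[b bB bmin]] := eqVneq B [::].
    by exists 0; rewrite ?A0.
  exists (b - 1) => [a|b' /bmin]; first by rewrite A0.
  by rewrite lerN2; lra.
have [hi lt_lohi hiB] : exists2 hi, lo < hi & forall b, b \in B -> hi <= b.
  have [->|/(@seq_argmax _ _ -%R)[b bB bmin]] := eqVneq B [::].
    by exists (lo + 1) => //; lra.
  by exists b; [exact: loB|move=> b' /bmin; rewrite lerN2].
have [x xs /andP[lox xhi]] := @seq_avoid_between _ s _ _ lt_lohi.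
exists x; split=> // [a /loA/le_lt_trans|b /hiB]; first exact.
exact: lt_le_trans.
Qed.

(** * Sheared coordinates and points in general position *)

Section Shear.
Context {R : realType}.
Implicit Types (mu : R) (p q r z v : plane R) (P : {fset plane R}) (h : seq (plane R)).

(* For a vertical-like direction (mu, 1), [abscissa mu] is constant along it;
   [(abscissa mu, ordinate)] are the coordinates sheared so that the direction
   becomes (0, 1). *)
Definition dir mu : plane R := \row_(j < 2) (if j == ord0 then mu else 1).
Definition abscissa mu p : R := p ord0 ord0 - mu * p ord0 ord_max.
Definition ordinate p : R := p ord0 ord_max.

(** A determinant, hence independent of [mu]. When [p] is left of [q], [orient mu p q z] is positive
    exactly when [z] is above the line [p q]. *)
Definition cross mu p q : R := abscissa mu p * ordinate q - abscissa mu q * ordinate p.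
Definition orient mu p q z : R := cross mu (q - p) (z - p).

Lemma abscissaD mu p q : abscissa mu (p + q) = abscissa mu p + abscissa mu q.
Proof. by rewrite /abscissa !mxE; ring. Qed.

Lemma abscissaB mu p q : abscissa mu (p - q) = abscissa mu p - abscissa mu q.
Proof. by rewrite /abscissa !mxE; ring. Qed.

Lemma abscissaZ mu c p : abscissa mu (c *: p) = c * abscissa mu p.
Proof. by rewrite /abscissa !mxE; ring. Qed.

Lemma ordinateD p q : ordinate (p + q) = ordinate p + ordinate q.
Proof. by rewrite /ordinate mxE. Qed.

Lemma ordinateB p q : ordinate (p - q) = ordinate p - ordinate q.
Proof. by rewrite /ordinate !mxE. Qed.

Lemma ordinateZ c p : ordinate (c *: p) = c * ordinate p.
Proof. by rewrite /ordinate mxE. Qed.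

Lemma abscissa_dir mu : abscissa mu (dir mu) = 0.
Proof. by rewrite /abscissa !mxE/= mulr1 subrr. Qed.

Lemma ordinate_dir mu : ordinate (dir mu) = 1.
Proof. by rewrite /ordinate mxE. Qed.

Definition coordE := (abscissaB, abscissaD, abscissaZ, ordinateB, ordinateD, ordinateZ,
  abscissa_dir, ordinate_dir).

Lemma dir_neq0 mu : dir mu != 0.
Proof.
apply/eqP => /rowP/(_ ord_max); rewrite !mxE/= => /eqP; rewrite oner_eq0//.
Qed.

Lemma plane_eqP mu p q :
  abscissa mu p = abscissa mu q -> ordinate p = ordinate q -> p = q.
Proof.
rewrite /abscissa /ordinate => eqX eqY; apply/rowP => j.
case: (unliftP ord_max j) => [i ->|-> //].
have -> : lift ord_max i = ord0 :> 'I_2 by apply/val_inj; rewrite /= /bump ord1.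
by rewrite !ord1 eqY in eqX *; lra.
Qed.

Lemma plane_coord mu (x y : R) :
  exists2 z, abscissa mu z = x & ordinate z = y.
Proof.
exists (\row_(j < 2) (if j == ord0 then x + mu * y else y)); last by rewrite /ordinate mxE.
by rewrite /abscissa !mxE/=; ring.
Qed.

Lemma orient_cycle mu p q z : orient mu p q z = orient mu q z p.
Proof. by rewrite /orient /cross !coordE; ring. Qed.

Lemma orient_last mu p q : orient mu p q q = 0.
Proof. by rewrite /orient /cross !coordE; ring. Qed.

Lemma orient_first mu p q : orient mu p q p = 0.
Proof. by rewrite /orient /cross !coordE; ring. Qed.

Lemma collinear_orient mu p q z : collinear p q z -> orient mu p q z = 0.
Proof.
move=> [c0 [v [_ /= inl]]].
have [a _ <-] : [set c0 + x *: v | x in [set: R]] p by apply: inl; left; left.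
have [b _ <-] : [set c0 + x *: v | x in [set: R]] q by apply: inl; left; right.
have [c _ <-] : [set c0 + x *: v | x in [set: R]] z by apply: inl; right.
by rewrite /orient /cross !coordE; ring.
Qed.

Lemma orient_collinear mu p q z :
  abscissa mu p != abscissa mu q -> orient mu p q z = 0 -> collinear p q z.
Proof.
rewrite /orient /cross !coordE => neX o0.
have nz : abscissa mu q - abscissa mu p != 0 by rewrite subr_eq0 eq_sym.
exists p, (q - p); split.
  by apply: contraNneq neX => /eqP; rewrite subr_eq0 => /eqP->.
move=> w [[->|->]|->]; [exists 0|exists 1|
    exists ((abscissa mu z - abscissa mu p) / (abscissa mu q - abscissa mu p))] => //.
- by rewrite scale0r addr0.
- by rewrite scale1r addrC subrK.
- apply: (@plane_eqP mu); rewrite !coordE.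
    by rewrite divfK// addrC subrK.
  apply: (mulfI nz); rewrite mulrDr mulrA mulrCA divff// mulr1.
  by move/eqP: o0; rewrite subr_eq0 => /eqP/esym ->; ring.
Qed.

Lemma gp_orient mu h p q z : general_position h -> p \in h -> q \in h -> z \in h ->
  abscissa mu p < abscissa mu q -> p != z -> q != z -> orient mu p q z != 0.
Proof.
move=> [_ gp] ph qh zh lt_pq pz qz; apply/eqP => /orient_collinear col.
apply: (gp p q z) => //; last by apply: col; rewrite lt_eqF.
by apply: contraTneq lt_pq => ->; rewrite ltxx.
Qed.

(** Two distinct points share an abscissa only if [mu] is the inverse slope of their line, so
    finitely many values have to be avoided. *)
Lemma generic_dir h : exists mu, {in h &, injective (abscissa mu)}.
Proof.
pose bad := [seq (p ord0 ord0 - q ord0 ord0) / (p ord0 ord_max - q ord0 ord_max)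
            | p : plane R <- h, q : plane R <- h].
have [mu mubad _] := @seq_avoid_between _ bad 0 1 ltr01.
exists mu => p q ph qh eqX; apply: (@plane_eqP mu) => //; apply/eqP.
apply: contraNT mubad => neY; apply/allpairsP; exists (p, q); split=> //=.
move: eqX neY; rewrite /abscissa /ordinate => eqX neY.
have nz : p ord0 ord_max - q ord0 ord_max != 0 by rewrite subr_eq0.
by apply: (mulIf nz); rewrite divfK//; lra.
Qed.

(* With a fresh abscissa, every requirement is a strict inequality that holds
   as soon as the ordinate is large. *)
Lemma high_point mu h (x : R) : general_position h ->
  x \notin [seq abscissa mu p | p <- h] ->
  exists z, [/\ abscissa mu z = x, general_position (rcons h z) &
    forall p q r, p \in h -> q \in h -> r \in h ->
      abscissa mu p < abscissa mu q -> 0 < cross mu (q - p) (z - r)].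
Proof.
move=> [uh gph] xh.
(* The ordinate at abscissa [x] of the line through [r] parallel to [p q]; [z] is placed above all
   of these. *)
pose b (p q r : plane R) := ordinate r + (x - abscissa mu r) * (ordinate q - ordinate p)
  / (abscissa mu q - abscissa mu p).
pose bounds := [seq b pq.1 pq.2 r | pq <- [seq (p, q) | p <- h, q <- h], r <- h].
have [y [_ yb _]] := @seq_avoid_gap _ bounds [::] [::] (fun _ _ _ => ltac:(by [])).
have [z zx zy] := plane_coord mu x y; exists z.
have high p q r : p \in h -> q \in h -> r \in h ->
    abscissa mu p < abscissa mu q -> 0 < cross mu (q - p) (z - r).
  move=> ph qh rh lt_pq; have : b p q r < y.
    by apply/yb/allpairsP; exists ((p, q), r); split=> //=; apply/allpairsP; exists (p, q).
  have d0 : 0 < abscissa mu q - abscissa mu p by rewrite subr_gt0.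
  rewrite /b -ltrBrDl ltr_pdivrMr// /cross !coordE zx zy; lra.
have zNh : z \notin h by apply: contra xh => zh; rewrite -zx map_f.
(* Taking [r] to be [p] in [high] keeps [z] off the nonvertical lines; the vertical ones are missed
   because [x] is fresh. *)
have Nzcol p q : p \in h -> q \in h -> p != q -> ~ collinear p q z.
  move=> ph qh pq /(@collinear_orient mu).
  have [ltX|ltX|eqX] := ltgtP (abscissa mu p) (abscissa mu q).
  - by apply/eqP; rewrite gt_eqF//; exact: high.
  - suff: 0 < orient mu q p z by rewrite /orient /cross !coordE; lra.
    exact: high.
  - rewrite /orient /cross !coordE eqX subrr mul0r sub0r => /eqP.
    rewrite oppr_eq0 mulf_eq0 !subr_eq0 zx => /orP[/eqP xq|/eqP eqY].
      by move/negP: xh; apply; rewrite xq map_f.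
    by move/eqP: pq; apply; apply: (@plane_eqP mu).
have colP p q r p' q' r' : collinear p q r -> [set p'; q'; r'] `<=` [set p; q; r] ->
    collinear p' q' r'.
  by move=> [c0 [v [v0 sub]]] sub'; exists c0, v; split=> // w /sub' /sub.
split=> //; split; first by rewrite rcons_uniq zNh.
move=> p q r; rewrite !mem_rcons !inE => /predU1P[->|ph] /predU1P[->|qh] /predU1P[->|rh];
  rewrite ?eqxx// => pq pr qr col.
- by apply: (Nzcol q r) => //; apply: colP col _ => w [[->|->]|->]; [left; right|right|left; left].
- by apply: (Nzcol p r) => //; apply: colP col _ => w [[->|->]|->]; [left; left|right|left; right].
- exact: (Nzcol p q).
- exact: (gph p q r).
Qed.

Lemma legal_move_exists h : general_position h -> exists z, general_position (rcons h z).
Proof.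
move=> gph.
have [x xh _] := @seq_avoid_between _ [seq abscissa 0 p | p <- h] 0 1 ltr01.
by have [z []] := high_point gph xh; exists z.
Qed.

End Shear.

(** * Empty chains are strips *)

Section AffineForms.
Context {R : realType} (mu a b c : R).
Implicit Types (A : set (plane R)) (P : {fset plane R}).

(** The sides of a strip region ([b = 0]) and the lines supporting it from below ([b > 0]) are all
    zero sets of such forms. *)
Definition affine_form (z : plane R) : R := a * abscissa mu z + b * ordinate z + c.

Lemma affine_form_continuous : continuous affine_form.
Proof.
have coord_c j : continuous (fun z : plane R => z ord0 j).
  exact: (@coord_continuous R 1 2 ord0 j).
move=> z; have Fz : Filter (nbhs z) := nbhs_filter z.
have [cx cy] := (coord_c ord0 z, coord_c ord_max z).
have cX : abscissa mu w @[w --> z] --> abscissa mu z.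
  exact: (cvgB cx (cvgM (cvg_cst mu) cy)).
exact: (cvgD (cvgD (cvgM (cvg_cst a) cX) (cvgM (cvg_cst b) cy)) (cvg_cst c)).
Qed.

Lemma affine_form_conv (x : R) p q :
  affine_form (x *: p + (1 - x) *: q) = x * affine_form p + (1 - x) * affine_form q.
Proof. by rewrite /affine_form !coordE; ring. Qed.

Lemma hull_affine_ge0 A : (forall p, A p -> 0 <= affine_form p) ->
  forall z, hull A z -> 0 <= affine_form z.
Proof.
move=> A_ge0 z; apply: (@smallest_sub _ _ _ [set z | 0 <= affine_form z]) => //.
move=> p q l; rewrite !inE /= => p0 q0.
rewrite (affine_form_conv l%:num).
have /andP[l0 l1] : 0 <= l%:num <= 1 by apply/andP; split.
by apply: addr_ge0; apply: mulr_ge0 => //; lra.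
Qed.

Lemma hull_affine_gt0 A : (forall p, A p -> 0 < affine_form p) ->
  forall z, hull A z -> 0 < affine_form z.
Proof.
move=> A_gt0 z; apply: (@smallest_sub _ _ _ [set z | 0 < affine_form z]) => //.
move=> p q l; rewrite !inE /= => p0 q0.
rewrite (affine_form_conv l%:num).
have /andP[l0 l1] : 0 <= l%:num <= 1 by apply/andP; split.
by nra.
Qed.

Lemma strip_region_affine_ge0 P : 0 <= b -> (forall p, p \in P -> 0 <= affine_form p) ->
  forall z, strip_region P (dir mu) z -> 0 <= affine_form z.
Proof.
move=> b0 P_ge0 z [p /(hull_affine_ge0 P_ge0) p0 [_ [x /= x0 <-] <-]].
move: p0; rewrite /affine_form !coordE mulr0 mulr1 addr0 mulrDr.
by have := mulr_ge0 b0 x0; lra.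
Qed.

Lemma closure_affine_ge0 A : (forall p, A p -> 0 <= affine_form p) ->
  forall z, closure A z -> 0 <= affine_form z.
Proof.
move=> A_ge0; suff cl : closed [set z | 0 <= affine_form z].
  by rewrite closureE; exact: smallest_sub cl A_ge0.
apply: (@closed_comp _ _ affine_form [set x | 0 <= x]); last exact: closed_ge.
by move=> z _; exact: affine_form_continuous.
Qed.

(** From an interior point a small step [e] against the gradient stays in [A], and it lowers the
    form by [e * (a ^+ 2 + b ^+ 2)]. *)
Lemma interior_affine_gt0 A : (a != 0) || (b != 0) ->
  (forall p, A p -> 0 <= affine_form p) ->
  forall z, interior A z -> 0 < affine_form z.
Proof.
move=> ab A_ge0 z intz; have [d da db] := plane_coord mu (- a) (- b).
have cv : (fun e : R => z + e *: d) @ 0^'+ --> z.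
  rewrite -[X in _ --> X]addr0 -(scale0r d); apply: cvg_at_right_filter.
  by apply: cvgD; [exact: cvg_cst|apply: cvgZr_tmp; exact: cvg_id].
have /filter_ex[e [/= /A_ge0 ge0 e0]] : \forall e \near 0^'+, A (z + e *: d) /\ 0 < e.
  near=> e; split; last by near: e; exact: nbhs_right_gt.
  by near: e; exact: cv intz.
have : 0 < a ^+ 2 + b ^+ 2.
  by rewrite lt_neqAle addr_ge0 ?sqr_ge0// eq_sym paddr_eq0 ?sqr_ge0// !sqrf_eq0 negb_and ab.
move: ge0; rewrite /affine_form !coordE da db.
have -> : a * (abscissa mu z + e * - a) + b * (ordinate z + e * - b) + c =
  a * abscissa mu z + b * ordinate z + c - e * (a ^+ 2 + b ^+ 2) by ring.
by move=> ge0 /(mulr_gt0 e0); lra.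
Unshelve. all: by end_near.
Qed.

End AffineForms.

Section Chains.
Context {R : realType} (mu : R).
Implicit Types (p q r z : plane R) (P : {fset plane R}) (h : seq (plane R)).
Local Notation X := (abscissa mu).
Local Notation orient := (orient mu).

(** Supporting lines of the lower hull of [P], directed from left to right. *)
Definition edge P p q : Prop :=
  [/\ p \in P, q \in P, X p < X q & forall r, r \in P -> 0 <= orient p q r].

(* A superset of the region [strip_region P (dir mu)], given by inequalities. *)
Definition above P z : Prop :=
  [/\ exists2 p, p \in P & X p <= X z, exists2 p, p \in P & X z <= X p &
      forall p q, edge P p q -> 0 <= orient p q z].

(** A cup in the sense of Erdős and Szekeres: every triple turns left when read by increasing
    abscissa. *)
Definition convex_chain P : Prop :=
  {in P &, injective X} /\
  forall p q r, p \in P -> q \in P -> r \in P -> X p < X q -> X q < X r -> 0 < orient p q r.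

Definition empty_chain (k : nat) h P : Prop :=
  [/\ #|` P| = k, {subset P <= h}, convex_chain P &
      forall z, z \in h -> above P z -> z \in P].

Lemma orient_affine p q z : orient p q z =
  affine_form mu (- (ordinate q - ordinate p)) (X q - X p)
    ((ordinate q - ordinate p) * X p - (X q - X p) * ordinate p) z.
Proof. by rewrite /orient /cross /affine_form !coordE; ring. Qed.

(** The successor of [p] by abscissa works: any third point is left or right of both ends, and the
    left turn of that triple puts it above the line. *)
Lemma next_edge P p r : convex_chain P -> p \in P -> r \in P -> X p < X r ->
  exists q, edge P p q.
Proof.
move=> [injP convP] pP rP lt_pr.
have [|q] := @seq_argmax R _ (fun q => - X q) [seq q <- P : seq _ | X p < X q].
  by rewrite -has_filter; apply/hasP; exists r.
rewrite mem_filter => /andP[lt_pq qP] qmin; exists q; split=> // z zP.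
have [lt_zp|lt_pz|/injP->//] := ltgtP (X z) (X p); last by rewrite orient_first.
  by rewrite -orient_cycle ltW// convP.
have [lt_zq|lt_qz|/injP->//] := ltgtP (X z) (X q); last by rewrite orient_last.
  by have := qmin z; rewrite mem_filter lt_pz zP => /(_ isT); rewrite lerN2 leNgt lt_zq.
by rewrite ltW// convP.
Qed.

Lemma prev_edge P p r : convex_chain P -> p \in P -> r \in P -> X r < X p ->
  exists q, edge P q p.
Proof.
move=> [injP convP] pP rP lt_rp.
have [|q] := @seq_argmax R _ X [seq q <- P : seq _ | X q < X p].
  by rewrite -has_filter; apply/hasP; exists r.
rewrite mem_filter => /andP[lt_qp qP] qmax; exists q; split=> // z zP.
have [lt_zp|lt_pz|/injP->//] := ltgtP (X z) (X p); last by rewrite orient_last.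
  have [lt_zq|lt_qz|/injP->//] := ltgtP (X z) (X q); last by rewrite orient_first.
    by rewrite -orient_cycle ltW// convP.
  by have := qmax z; rewrite mem_filter lt_zp zP => /(_ isT); rewrite leNgt lt_qz.
by rewrite ltW// convP.
Qed.

Lemma abscissa_affine p z : X z - X p = affine_form mu 1 0 (- X p) z.
Proof. by rewrite /affine_form; ring. Qed.

Lemma abscissa_affineN p z : X p - X z = affine_form mu (-1) 0 (X p) z.
Proof. by rewrite /affine_form; ring. Qed.

Lemma fset_extremes P p : p \in P ->
  exists lo hi, [/\ lo \in P, hi \in P & forall q, q \in P -> X lo <= X q <= X hi].
Proof.
move=> pP; have P0 : (P : seq (plane R)) != [::].
  by apply/eqP => P0; move: pP; rewrite -[_ \in P]/(p \in (P : seq _)) P0.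
have [hi hiP himax] := @seq_argmax R _ X _ P0.
have [lo loP lomin] := @seq_argmax R _ (fun q => - X q) _ P0.
exists lo, hi; split=> // q qP; rewrite himax// andbT -lerN2.
exact: lomin.
Qed.

(** Each half-plane defining [above] is closed, contains [P] and is stable under upward
    translation. *)
Lemma closure_strip_region P p z : p \in P -> closure (strip_region P (dir mu)) z -> above P z.
Proof.
move=> pP clz; have [lo [hi [loP hiP bnd]]] := fset_extremes pP; split.
- exists lo => //; rewrite -subr_ge0 abscissa_affine; apply: closure_affine_ge0 clz.
  apply: strip_region_affine_ge0 => // q /bnd/andP[].
  by rewrite -subr_ge0 abscissa_affine.
- exists hi => //; rewrite -subr_ge0 abscissa_affineN; apply: closure_affine_ge0 clz.
  apply: strip_region_affine_ge0 => // q /bnd/andP[_].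
  by rewrite -subr_ge0 abscissa_affineN.
- move=> q r [qP rP lt_qr ge0]; rewrite orient_affine; apply: closure_affine_ge0 clz.
  apply: strip_region_affine_ge0 => [|w wP]; first by rewrite subr_ge0 ltW.
  by rewrite -orient_affine ge0.
Qed.

Lemma sub_strip_region P p : p \in P -> strip_region P (dir mu) p.
Proof.
move=> pP; exists p; first by apply: sub_gen_smallest.
by exists 0; [exists 0; rewrite /= ?scale0r|rewrite addr0].
Qed.

(** [p] is on the border of a half-plane containing the region: the one above the edge leaving [p],
    or, for the rightmost point, the one left of the vertical line through it. *)
Lemma chain_not_interior P p : convex_chain P -> p \in P ->
  ~ interior (strip_region P (dir mu)) p.
Proof.
move=> ccP pP; have [lo [hi [loP hiP bnd]]] := fset_extremes pP.
have [lt_php|le_hip] := ltP (X p) (X hi).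
  have [q [_ qP lt_pq ge0]] := next_edge ccP pP hiP lt_php.
  have : orient p q p = 0 by exact: orient_first.
  rewrite orient_affine => f0 /interior_affine_gt0 => int.
  suff : 0 < 0 :> R by rewrite ltxx.
  rewrite -{2}f0; apply: int; first by rewrite subr_eq0 (gt_eqF lt_pq) orbT.
  apply: strip_region_affine_ge0 => [|w wP]; first by rewrite subr_ge0 ltW.
  by rewrite -orient_affine ge0.
move=> /interior_affine_gt0 => int; suff : 0 < 0 :> R by rewrite ltxx.
rewrite -{2}(subrr (X p)) abscissa_affineN; apply: int; first by rewrite oppr_eq0 oner_eq0.
apply: strip_region_affine_ge0 => // w /bnd/andP[_ /le_trans/(_ le_hip)].
by rewrite -subr_ge0 abscissa_affineN.
Qed.

(** A vertical line isolates an extreme point. For an inner point the forms of its two incident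
    edges are added: the sum vanishes at [p] and is positive at all other points of [P]. *)
Lemma chain_convex_position P : convex_chain P -> convex_position P.
Proof.
move=> ccP p pP; have [injP convP] := ccP; have [lo [hi [loP hiP bnd]]] := fset_extremes pP.
have neX q : ([set` P] `\ p) q -> q \in P /\ X q != X p.
  by move=> [/= qP qp]; split=> //; apply/eqP => eqX; apply: qp; exact: injP.
have [lt_php|le_hip] := ltP (X p) (X hi); last first.
  move=> /hull_affine_gt0 => gt0; suff : 0 < 0 :> R by rewrite ltxx.
  rewrite -{2}(subrr (X p)) abscissa_affineN; apply: gt0 => q /neX[qP neqX].
  by rewrite -abscissa_affineN subr_gt0 lt_neqAle neqX; have := bnd q qP; lra.
have [lt_lop|le_plo] := ltP (X lo) (X p); last first.
  move=> /hull_affine_gt0 => gt0; suff : 0 < 0 :> R by rewrite ltxx.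
  rewrite -{2}(subrr (X p)) abscissa_affine; apply: gt0 => q /neX[qP neqX].
  by rewrite -abscissa_affine subr_gt0 lt_neqAle eq_sym neqX; have := bnd q qP; lra.
have [q [_ qP lt_pq q_ge0]] := next_edge ccP pP hiP lt_php.
have [r [rP _ lt_rp r_ge0]] := prev_edge ccP pP loP lt_lop.
(* The sum of the two forms vanishes on the line through [p] parallel to [r q]. *)
pose dx := (X q - X p) + (X p - X r).
pose dy := (ordinate q - ordinate p) + (ordinate p - ordinate r).
have fE z : orient p q z + orient r p z =
    affine_form mu (- dy) dx (dy * X p - dx * ordinate p) z.
  by rewrite /dx /dy /orient /cross /affine_form !coordE; ring.
move=> /hull_affine_gt0 => gt0; suff : 0 < 0 :> R by rewrite ltxx.
have {2}<- : orient p q p + orient r p p = 0 by rewrite orient_first orient_last addr0.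
rewrite fE; apply: gt0 => z /neX[zP neqX]; rewrite -fE.
have [lt_zp|lt_pz|eqX] := ltgtP (X z) (X p); last by rewrite eqX eqxx in neqX.
  by apply: ltr_pwDl; [rewrite -orient_cycle convP|exact: r_ge0].
by apply: ltr_wpDl; [exact: q_ge0|rewrite convP].
Qed.

Lemma empty_chain_k_strip k h P : (0 < k)%N -> empty_chain k h P ->
  k_strip [set` h] k (dir mu) P.
Proof.
move=> k0 [sizeP subP ccP emptyP].
have [p pP] : exists p, p \in P by apply/fset0Pn; rewrite -cardfs_gt0 sizeP.
have inP z : closure (strip_region P (dir mu)) z -> z \in h -> z \in P.
  by move=> /(closure_strip_region pP) zab zh; exact: emptyP.
split; first by split; [move=> z /subP|exact: sizeP|exact: chain_convex_position].
split; first exact: dir_neq0.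
- apply/seteqP; split=> // z [zint /= zh].
  apply: (chain_not_interior ccP (inP z _ zh)) (zint).
  exact: subset_closure (interior_subset zint).
- apply/seteqP; split=> [z [[zcl _] /inP]|z zP]; first exact.
  split; last exact: subP.
  split; first exact/subset_closure/sub_strip_region.
  exact: chain_not_interior.
Qed.

(** The order from left to right makes the regions disjoint, and lets a single abscissa split the
    family into an initial and a final part. *)
Definition chain_family (k N : nat) h (P : nat -> {fset plane R}) : Prop :=
  (forall i, (i < N)%N -> empty_chain k h (P i)) /\
  forall i j p q, (i < j < N)%N -> p \in P i -> q \in P j -> X p < X q.

Lemma strip_region_disjoint P1 P2 p1 p2 : p1 \in P1 -> p2 \in P2 ->
  (forall p q, p \in P1 -> q \in P2 -> X p < X q) ->
  strip_region P1 (dir mu) `&` strip_region P2 (dir mu) = set0.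
Proof.
move=> p1P p2P lt12; apply/seteqP; split=> // z [/subset_closure z1 /subset_closure z2].
have [_ [p pP le_zp] _] := closure_strip_region p1P z1.
have [[q qP le_qz] _ _] := closure_strip_region p2P z2.
by have := lt12 p q pP qP; rewrite ltNge (le_trans le_qz).
Qed.

Lemma chain_family_parallel k N h (P : nat -> {fset plane R}) :
  (0 < k)%N -> chain_family k N h P ->
  parallel_strips k N h.
Proof.
move=> k0 [emptyP sortP].
have stripP (i : 'I_N) : k_strip [set` h] k (dir mu) (P i).
  exact/empty_chain_k_strip/emptyP.
have mem0 (i : 'I_N) : exists p, p \in P i.
  by apply/fset0Pn; rewrite -cardfs_gt0; have [->] := emptyP i (ltn_ord i).
exists (dir mu), (fun i : 'I_N => P i); split=> // i j ij; split=> //.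
have [[p pP] [q qP]] := (mem0 i, mem0 j).
have [lt_ij|lt_ji|/val_inj/eqP] := ltngtP i j; last by rewrite (negPf ij).
  by apply: (strip_region_disjoint pP qP) => p' q'; apply: sortP; rewrite lt_ij /=.
rewrite setIC; apply: (strip_region_disjoint qP pP) => p' q'.
by apply: sortP; rewrite lt_ji /=.
Qed.

End Chains.

(** * Creating and extending chains *)

Section ChainConstructions.
Context {R : realType}.
Implicit Types (mu : R) (p q r z : plane R) (P : {fset plane R}) (h : seq (plane R)).

(** The points are sorted along a generic direction and cut into runs of [k]; a run is empty because
    no other point has an abscissa within its range. *)
Lemma base_chain_family k N h : (0 < k <= 2)%N -> size h = (k * N)%N ->
  general_position h -> exists mu (P : nat -> {fset plane R}), chain_family mu k N h P.
Proof.
move=> /andP[k0 k2] szh [uh _]; have [mu inj_mu] := generic_dir h.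
pose X := abscissa mu.
pose s := sort (fun p q => X p <= X q) h; pose x i := nth 0 s i.
have sh : s =i h by exact: mem_sort.
have szs : size s = (k * N)%N by rewrite size_sort.
have us : uniq s by rewrite sort_uniq.
have mem_x i : (i < k * N)%N -> x i \in s by move=> ?; rewrite mem_nth// szs.
have ltX i j : (i < j < k * N)%N -> X (x i) < X (x j).
  move=> /andP[ij jN]; have iN := ltn_trans ij jN.
  rewrite lt_neqAle; apply/andP; split.
    apply/eqP => /(inj_mu (x i) (x j)); rewrite -!sh !mem_x// => /(_ isT isT)/eqP.
    by rewrite nth_uniq ?szs// ltn_eqF.
  have srt : sorted (fun p q => X p <= X q) s by apply: sort_sorted => p q; exact: le_total.
  apply: (sorted_ltn_nth _ _ srt) => //; rewrite ?inE ?szs//.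
  by move=> q p r; exact: le_trans.
have leX i j : (i < k * N)%N -> (j < k * N)%N -> X (x i) <= X (x j) -> (i <= j)%N.
  by move=> iN jN; rewrite leNgt leqNgt; apply: contra => ji; rewrite ltX// ji.
pose blk i := map x (iota (i * k) k).
have blkP i p : reflect (exists2 j, (i * k <= j < i * k + k)%N & p = x j) (p \in blk i).
  apply: (iffP mapP) => -[j]; first by rewrite mem_iota => ? ->; exists j.
  by move=> ? ->; exists j; rewrite ?mem_iota.
have in_range i j : (i < N)%N -> (j < i * k + k)%N -> (j < k * N)%N.
  move=> iN /leq_trans; apply; rewrite addnC -mulSn mulnC; exact: leq_mul.
exists mu, (fun i => seq_fset tt (blk i)); split=> [i iN|i j p q /andP[ij jN]]; last first.
  rewrite !seq_fsetE => /blkP[a /andP[_ ai] ->] /blkP[b /andP[bj bj'] ->].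
  apply: ltX; rewrite (in_range j)// andbT (leq_trans ai)// (leq_trans _ bj)//.
  by rewrite addnC -mulSn leq_mul.
have xi j : (j < i * k + k)%N -> (j < k * N)%N by exact: in_range.
split.
- rewrite size_seq_fset undup_id ?size_map ?size_iota// map_inj_in_uniq ?iota_uniq//.
  move=> a b; rewrite !mem_iota => /andP[_ /xi aN] /andP[_ /xi bN] /eqP.
  by rewrite nth_uniq ?szs// => /eqP.
- by move=> p; rewrite seq_fsetE => /blkP[j /andP[_ /xi jN] ->]; rewrite -sh mem_x.
- split=> [p q|p q r]; rewrite !seq_fsetE.
    move=> /blkP[a /andP[_ /xi aN] ->] /blkP[b /andP[_ /xi bN] ->].
    by apply: inj_mu; rewrite -sh mem_x.
  (* Convexity is vacuous: three distinct points do not fit in a run of length at most 2. *)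
  move=> pP qP rP pq qr; suff : (size [:: p; q; r] <= 2)%N by [].
  apply: leq_trans k2; rewrite -[leqRHS](size_iota (i * k)) -(size_map x).
  apply: uniq_leq_size; last by move=> w; rewrite !inE => /or3P[] /eqP->.
  have neq u v : X u < X v -> u != v by move=> uv; apply: contraTneq uv => ->; rewrite ltxx.
  by rewrite /= !inE negb_or !neq// (lt_trans pq).
- move=> z; rewrite -sh => /(nthP 0)[c]; rewrite szs => cN <-.
  move=> [[p pP le_pz] [q qP le_zq] _]; rewrite seq_fsetE; apply/blkP; exists c => //.
  move: pP qP le_pz le_zq; rewrite !seq_fsetE.
  move=> /blkP[a /andP[ia /xi aN] ->] /blkP[b /andP[_ ib] ->] /leX ac /leX cb.
  by rewrite (leq_trans ia) ?ac// (leq_ltn_trans _ ib)// cb// xi.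
Qed.

(** For vectors pointing to the right the sign of [cross] compares slopes, so this is transitivity
    of the slope order. *)
Lemma cross_trans mu a u w : 0 < abscissa mu a -> 0 < abscissa mu u -> 0 < abscissa mu w ->
  0 < cross mu a u -> 0 <= cross mu u w -> 0 < cross mu a w.
Proof.
move=> a0 u0 w0 au uw; rewrite -(pmulr_rgt0 _ u0).
have -> : abscissa mu u * cross mu a w
    = cross mu a u * abscissa mu w + cross mu u w * abscissa mu a.
  by rewrite /cross; ring.
by apply: ltr_wpDr; [exact: mulr_ge0 (ltW a0)|exact: mulr_gt0].
Qed.

Lemma extend_chain mu k h P q :
  general_position h -> (0 < k)%N -> empty_chain mu k h P -> q \in h ->
  (forall p, p \in P -> abscissa mu p < abscissa mu q) ->
  (forall a b c, a \in P -> b \in P -> c \in P -> abscissa mu a < abscissa mu b ->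
    0 < cross mu (b - a) (q - c)) ->
  exists r, [/\ abscissa mu r <= abscissa mu q,
    forall p, p \in P -> abscissa mu p < abscissa mu r &
    empty_chain mu k.+1 h (r |` P)%fset].
Proof.
move=> gph k0 [sizeP subP ccP emptyP] qh ltPq steep; have [injP convP] := ccP.
have [p0 p0P] : exists p, p \in P by apply/fset0Pn; rewrite -cardfs_gt0 sizeP.
have [lo [p [loP pP le_Pp]]] := fset_extremes mu p0P.
have {}le_Pp a : a \in P -> abscissa mu a <= abscissa mu p by case/le_Pp/andP.
pose slope z := (ordinate z - ordinate p) / (abscissa mu z - abscissa mu p).
have [|r] := @seq_argmax R _ slope
    [seq z <- h | abscissa mu p < abscissa mu z <= abscissa mu q].
  by rewrite -has_filter; apply/hasP; exists q; rewrite // ltPq//=.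
rewrite mem_filter => /andP[/andP[lt_pr le_rq] rh] rmax.
have {}rmax z : z \in h -> abscissa mu p < abscissa mu z -> abscissa mu z <= abscissa mu q ->
    0 <= orient mu p z r.
  move=> zh lt_pz le_zq; have := rmax z; rewrite mem_filter lt_pz le_zq zh => /(_ isT).
  rewrite /slope ler_pdivrMr ?subr_gt0// mulrAC ler_pdivlMr ?subr_gt0//.
  by rewrite /orient /cross !coordE; lra.
have ltPr a : a \in P -> abscissa mu a < abscissa mu r by move=> /le_Pp/le_lt_trans; apply.
have convr a b : a \in P -> b \in P -> abscissa mu a < abscissa mu b -> 0 < orient mu a b r.
  move=> aP bP lt_ab.
  (* [p] is on or above the line [a b], and going from [p] to [r] is steeper than [a b]: the slope
     of [p q] lies in between, by [steep] and by maximality of [r]. *)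
  have -> : orient mu a b r = orient mu a b p + cross mu (b - a) (r - p).
    by rewrite /orient /cross !coordE; ring.
  apply: ltr_wpDl.
    have := le_Pp b bP; rewrite le_eqVlt => /predU1P[/injP-> //|lt_bp].
      by rewrite orient_last.
    by rewrite ltW// convP.
  apply: (@cross_trans mu _ (q - p)); rewrite ?abscissaB ?subr_gt0//;
    last by apply: (rmax q) => //; exact: ltPq.
  - exact: ltPq.
  - by rewrite -subr_gt0; exact: steep.
exists r; split=> //.
have rNP : r \notin P by apply/negP => /ltPr; rewrite ltxx.
have conv' a b c : a \in (r |` P)%fset -> b \in (r |` P)%fset -> c \in (r |` P)%fset ->
    abscissa mu a < abscissa mu b -> abscissa mu b < abscissa mu c -> 0 < orient mu a b c.
  move=> aP' bP' cP' lt_ab lt_bc.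
  have lerP d : d \in (r |` P)%fset -> abscissa mu d <= abscissa mu r.
    by rewrite in_fset1U => /predU1P[->|/ltPr/ltW].
  have inP d e : d \in (r |` P)%fset -> e \in (r |` P)%fset ->
      abscissa mu d < abscissa mu e -> d \in P.
    move=> + /lerP le_er; rewrite in_fset1U => /predU1P[->|//].
    by rewrite ltNge le_er.
  have aP := inP _ _ aP' bP' lt_ab; have bP := inP _ _ bP' cP' lt_bc.
  by move: cP' lt_bc; rewrite in_fset1U => /predU1P[-> _|cP lt_bc]; [exact: convr|exact: convP].
split.
- by rewrite cardfsU1 rNP sizeP.
- by move=> z; rewrite in_fset1U => /predU1P[->//|/subP].
- split=> // a b; rewrite !in_fset1U => /predU1P[->|aP] /predU1P[->|bP] // eqX.
  + by have := ltPr b bP; rewrite -eqX ltxx.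
  + by have := ltPr a aP; rewrite eqX ltxx.
  + exact: injP.
- move=> z zh [[l lP le_lz] [hi hiP' le_zhi] edges]; rewrite in_fset1U.
  (* Up to the abscissa of [p] emptiness is inherited: an edge of [P] remains an edge after adding
     [r], which lies above it. *)
  have [le_zp|lt_pz] := leP (abscissa mu z) (abscissa mu p).
    apply/orP; right; apply: emptyP => //; split.
    + exists l => //; move: lP; rewrite in_fset1U => /predU1P[lr|//].
      by have := ltPr p pP; rewrite -lr; lra.
    + by exists p.
    + move=> a b [aP bP lt_ab ge0]; apply: edges; split=> //; rewrite ?in_fset1U ?aP ?bP ?orbT//.
      move=> c; rewrite in_fset1U => /predU1P[->|/ge0//]; exact/ltW/convr.
  have le_zr : abscissa mu z <= abscissa mu r.
    by move: hiP'; rewrite in_fset1U => /predU1P[<-//|/le_Pp]; lra.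
  have pr_edge : edge mu (r |` P)%fset p r.
    split=> //; rewrite ?in_fset1U ?pP ?eqxx ?orbT// => c.
    rewrite in_fset1U => /predU1P[->|cP].
      by rewrite orient_last.
    have := le_Pp c cP; rewrite le_eqVlt => /predU1P[/injP->//|lt_cp].
      by rewrite orient_first.
    by rewrite -orient_cycle ltW// convr.
  (* Beyond [p], the edge [p r] puts [z] on or above the line [p r] and the maximal slope of [r]
     puts it on or below; general position leaves only [z = r]. *)
  have [//|zr] := eqVneq z r.
  have : orient mu p r z != 0.
    apply: (gp_orient gph) => //; [exact: subP| |by rewrite eq_sym].
    by apply: contraTneq lt_pz => ->; rewrite ltxx.
  have := edges _ _ pr_edge; have := rmax z zh lt_pz (le_trans le_zr le_rq).
  have -> : orient mu p z r = - orient mu p r z by rewrite /orient /cross !coordE; ring.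
  by rewrite oppr_ge0 => le0 ge0; rewrite eq_le le0 ge0.
Qed.

End ChainConstructions.

(** * Forcing a position *)

Section Forcing.
Context {R : realType} (s : R).
Implicit Types (goal : seq (plane R) -> Prop) (h : seq (plane R)) (z : plane R).

(** The game tree truncated at depth [d]; since the goal is tested after exactly [d] moves,
    successive phases can be concatenated. *)
Fixpoint forces goal (d : nat) h : Prop :=
  if d is d'.+1 then
    if maker_turn s (size h) then
      exists z, general_position (rcons h z) /\ forces goal d' (rcons h z)
    else forall z, general_position (rcons h z) -> forces goal d' (rcons h z)
  else goal h.

Lemma forcesD goal d1 d2 h : forces (forces goal d2) d1 h -> forces goal (d1 + d2) h.
Proof.
elim: d1 h => //= d1 IHd h; case: ifP => _.
  by move=> [z [gpz /IHd Fz]]; exists z.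
by move=> F z gpz; apply/IHd/F.
Qed.

Lemma forces_mono goal1 goal2 d h : general_position h ->
  (forall h', general_position h' -> size h' = (size h + d)%N -> goal1 h' -> goal2 h') ->
  forces goal1 d h -> forces goal2 d h.
Proof.
elim: d h => [|d IHd] h gph sub12 /=; first by apply: sub12; rewrite ?addn0.
have IH z : general_position (rcons h z) -> forces goal1 d (rcons h z) ->
    forces goal2 d (rcons h z).
  by move=> gpz; apply: IHd => // h' gph'; rewrite size_rcons addSnnS; exact: sub12.
case: ifP => _ F.
  by have [z [gpz Fz]] := F; exists z; split=> //; exact: IH.
by move=> z gpz; apply/IH/F.
Qed.

Lemma forces_always goal d h : general_position h ->
  (forall h', general_position h' -> size h' = (size h + d)%N -> goal h') ->
  forces goal d h.
Proof.
elim: d h => [|d IHd] h gph all_goal /=; first by apply: all_goal; rewrite ?addn0.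
have IH z : general_position (rcons h z) -> forces goal d (rcons h z).
  by move=> gpz; apply: IHd => // h' gph'; rewrite size_rcons addSnnS; exact: all_goal.
case: ifP => _; last exact: IH.
by have [z gpz] := legal_move_exists gph; exists z; split=> //; exact: IH.
Qed.

(** Choice provides, at every position, a legal move that keeps the goal forced in the remaining
    moves if there is one, and any legal move otherwise; along a play that follows it the position
    stays forced. *)
Lemma forces_strategy goal n : forces goal n [::] ->
  exists sigma, maker_strategy s sigma /\
    forall x, legal_play x -> follows s sigma x -> goal (mkseq x n).
Proof.
move=> F0.
have [sigma good] : {sigma : seq (plane R) -> plane R & forall h, general_position h ->
    general_position (rcons h (sigma h)) /\
    forall z, general_position (rcons h z) -> forces goal (n - (size h).+1) (rcons h z) ->
      forces goal (n - (size h).+1) (rcons h (sigma h))}.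
  apply: (@choice _ _ (fun h w => general_position h -> general_position (rcons h w) /\
    forall z, general_position (rcons h z) -> forces goal (n - (size h).+1) (rcons h z) ->
      forces goal (n - (size h).+1) (rcons h w))) => h.
  have [[z [gpz Fz]]|noF] := pselect (exists z, general_position (rcons h z) /\
      forces goal (n - (size h).+1) (rcons h z)); first by exists z.
  have [gph|Ngph] := pselect (general_position h); last by exists 0.
  have [z gpz] := legal_move_exists gph; exists z => _; split=> // w gpw Fw.
  by case: noF; exists w.
exists sigma; split=> [h gph _|x legal_x follow_x]; first by have [] := good h gph.
have Fi i : (i <= n)%N -> forces goal (n - i) (mkseq x i).
  elim: i => [|i IHi] lt_in; first by rewrite subn0.
  have := IHi (ltnW lt_in); rewrite -[in (n - i)%N]subSS subSn//= size_mkseq.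
  have -> : mkseq x i.+1 = rcons (mkseq x i) (x i) by rewrite mkseqS.
  case: ifP => [turn_i [z [gpz Fz]]|_]; last by apply; rewrite -mkseqS; exact: legal_x.
  rewrite follow_x//; have [_] := good _ (legal_x i); rewrite size_mkseq => /(_ z gpz); exact.
by have := Fi n (leqnn n); rewrite subnn.
Qed.

Lemma moves_count n : (moves s n).1 = count (maker_turn s) (iota 0 n).
Proof.
elim: n => // n IHn; rewrite -addn1 iotaD count_cat -IHn /= !add0n addn0 addn1 /= /maker_turn.
by case: (moves s n) => i j; case: ifP => _; rewrite ?addn1 ?addn0.
Qed.

(** Breaker moves only while [j < i * s] and Maker only once [i * s <= j], so each bound survives
    the move that threatens it. *)
Lemma moves_bounds n : 0 <= s -> let: (i, j) := moves s n in
  [/\ (i + j)%N = n, j%:R < i%:R * s + 1 & i = 0%N \/ (i%:R - 1) * s <= j%:R].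
Proof.
move=> s0; elim: n => [|n] /=; first by split; [|rewrite mul0r add0r ltr01|left].
case: (moves s n) => i j [<- ub lb]; case: leP => ij; split.
- by [].
- by rewrite -natr1 mulrDl; lra.
- by right; rewrite -natr1 addrK.
- by rewrite addnS.
- by rewrite -natr1 ltrD2r.
- by case: lb => [|lb]; [left|right; rewrite -natr1; lra].
Qed.

(** With fewer than [T] turns of Maker among [T * m.+1] moves, Breaker would make more than [T * m]
    of them, against [moves_bounds]. The least [d] with at least [T] turns has exactly [T], as a
    move adds at most one. *)
Lemma maker_turns_window m (n T : nat) : 1 <= s -> s <= m%:R ->
  exists2 d, (d <= T * m.+1)%N & count (maker_turn s) (iota n d) = T.
Proof.
move=> s1 sm; pose c d := count (maker_turn s) (iota n d).
have cE d : ((moves s n).1 + c d)%N = (moves s (n + d)).1.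
  by rewrite !moves_count iotaD count_cat.
have cT : (T <= c (T * m.+1))%N.
  rewrite leqNgt; apply/negP => ltT.
  have := cE (T * m.+1)%N.
  have := moves_bounds n (le_trans ler01 s1).
  have := moves_bounds (n + T * m.+1) (le_trans ler01 s1).
  case: (moves s n) (moves s _) => i j [i' j'] /= [sum' ub' _] [sum _ lb] i'E.
  have ij' : (j + T * m < j')%N by move: sum' sum i'E ltT; rewrite mulnS; lia.
  have : (j + T * m).+1%:R <= j'%:R :> R by rewrite ler_nat.
  rewrite -natr1 natrD natrM => jj'.
  have Tm : T%:R * s <= T%:R * m%:R :> R by rewrite ler_wpM2l ?ler0n.
  have i'i : i'%:R * s <= (i%:R + T%:R - 1) * s.
    apply: ler_wpM2r; first by lra.
    have : i'.+1%:R <= (i + T)%N%:R :> R by rewrite ler_nat; lia.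
    by rewrite -natr1 natrD; lra.
  case: lb => [i0|]; last by lra.
  have := ler0n R j; move: i'i; rewrite i0; lra.
have [d Td mind] := ex_minnP (ex_intro (fun d => T <= c d)%N _ cT).
exists d; first exact: mind.
apply/eqP; rewrite eqn_leq Td andbT; case: d Td mind => [//|d] _ mind.
have : (c d < T)%N by rewrite ltnNge; apply/negP => /mind; rewrite ltnn.
rewrite /c -[X in (_ -> (count _ (iota _ X) <= _)%N)]addn1 iotaD count_cat /=.
by case: maker_turn; lia.
Qed.

End Forcing.

(** * Pigeonhole for blocks of consecutive indices *)

Lemma count_mem_iota_le (D : seq nat) (n : nat) : (count [in D] (iota 0 n) <= size D)%N.
Proof.
rewrite -size_filter; apply: uniq_leq_size; first exact/filter_uniq/iota_uniq.
by move=> i; rewrite mem_filter => /andP[].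
Qed.

Lemma full_blocks_le (D : seq nat) (M T : nat) :
  (M * count (fun b => all [in D] (iota (b * M) M)) (iota 0 T) <= size D)%N.
Proof.
apply: leq_trans (count_mem_iota_le D (T * M)); elim: T => [|T IHT]; first by rewrite muln0.
rewrite -addn1 iotaD mulnDl mul1n iotaD !count_cat mulnDr leq_add// !add0n /= addn0.
case: (boolP (all _ _)) => [|_]; last by rewrite muln0.
by rewrite all_count muln1 size_iota => /eqP->.
Qed.

(** * One phase of Maker's strategy *)

Section Phase.
Context {R : realType} (s mu : R) (k m t T M : nat).
Context (h0 : seq (plane R)) (P : nat -> {fset plane R}).
Hypotheses (k_gt0 : (0 < k)%N) (familyP : chain_family mu k (T * M) h0 P).
Implicit Types (h : seq (plane R)) (p q z : plane R) (D : seq nat).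
Local Notation X := (abscissa mu).

(** Block [b] consists of the chains [b * M] to [b.+1 * M - 1]; [q] lies in the gap just after it
    and is steep for all chains. *)
Definition follows_block (b : nat) q : Prop := forall i, (i < T * M)%N ->
  (forall p, p \in P i -> if (i < b.+1 * M)%N then X p < X q else X q < X p) /\
  (forall p1 p2 p, p1 \in P i -> p2 \in P i -> p \in P i -> X p1 < X p2 ->
    0 < cross mu (p2 - p1) (q - p)).

(** [D] lists the chains that Breaker may have killed. *)
Definition empty_outside D h : Prop := forall i z, (i < T * M)%N -> i \notin D ->
  z \in h -> above mu (P i) z -> z \in P i.

Definition blocks_followed (c : nat) h : Prop :=
  forall b, (b < c)%N -> exists2 q, q \in h & follows_block b q.

(** The chains have disjoint ranges of abscissas; hence a point of Breaker kills at most one of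
    them. *)
Lemma above_inj i j z : (i < T * M)%N -> (j < T * M)%N ->
  above mu (P i) z -> above mu (P j) z -> i = j.
Proof.
move=> iN jN [[p pi le_pz] [p' p'i le_zp'] _] [[q qj le_qz] [q' q'j le_zq'] _].
have [_ sortP] := familyP; have [ij|ji|//] := ssrnat.ltngtP i j.
  by have := sortP i j p' q; rewrite ij jN ltNge (le_trans le_qz) // => /(_ isT p'i qj).
by have := sortP j i q' p; rewrite ji iN ltNge (le_trans le_pz) // => /(_ isT q'j pi).
Qed.

Lemma follows_block_not_above b q i : follows_block b q -> (i < T * M)%N ->
  ~ above mu (P i) q.
Proof.
move=> qb iN [[p pi le_pq] [p' p'i le_qp'] _]; have [sep _] := qb i iN.
have := (sep p pi, sep p' p'i); case: ifP => _ [].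
  by rewrite [X p' < _]ltNge le_qp'.
by rewrite ltNge le_pq.
Qed.

Lemma follows_block_exists h b : general_position h -> {subset h0 <= h} -> (b < T)%N ->
  exists2 z, general_position (rcons h z) & follows_block b z.
Proof.
move=> gph sub0 bT; have [emptyP sortP] := familyP.
have bM : (b.+1 * M <= T * M)%N by rewrite leq_mul2r bT orbT.
pose points I := [seq X p | p <- flatten [seq (P i : seq (plane R)) | i <- I]].
have pointsP I x : reflect (exists i p, [/\ i \in I, p \in P i & x = X p]) (x \in points I).
  apply: (iffP mapP) => [[p /flatten_mapP[i iI pi] ->]|[i [p [iI pi ->]]]]; first by exists i, p.
  by exists p => //; apply/flatten_mapP; exists i.
pose before := iota 0 (b.+1 * M); pose after := iota (b.+1 * M) (T * M - b.+1 * M).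
have [|x [xh xbefore xafter]] :=
    @seq_avoid_gap R (points before) (points after) [seq X p | p <- h].
  move=> _ _ /pointsP[i [p [+ pi ->]]] /pointsP[j [q [+ qj ->]]].
  rewrite !mem_iota /= add0n subnKC// => ib /andP[jb jN].
  by apply: (sortP i j) => //; rewrite jN (leq_trans ib).
have [z [zx gpz high]] := high_point gph xh; exists z => // i iN.
have subi p : p \in P i -> p \in h by move=> pi; apply: sub0; have [_ ->] := emptyP i iN.
split=> [p pi|p1 p2 p p1i p2i pi]; last by apply: high; exact: subi.
rewrite zx; case: ssrnat.ltnP => ib; [apply: xbefore|apply: xafter]; apply/pointsP; exists i, p.
  by rewrite mem_iota.
by rewrite mem_iota subnKC// ib.
Qed.

(** Invariant: the followed blocks and Maker's remaining turns add up to [T], and [size D] plus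
    Breaker's remaining moves is at most [m * T]. Maker serves the next block at each turn;
    Breaker's move adds at most one index to [D]. *)
Lemma phase_forces d h c D : general_position h -> {subset h0 <= h} ->
  blocks_followed c h -> empty_outside D h ->
  (c + count (maker_turn s) (iota (size h) d))%N = T ->
  (size D + d <= m * T + count (maker_turn s) (iota (size h) d))%N ->
  forces s (fun h' => [/\ {subset h0 <= h'}, blocks_followed T h' &
    exists2 D', empty_outside D' h' & (size D' <= m * T)%N]) d h.
Proof.
elim: d h c D => [|d IHd] h c D gph sub0 folc emptyD /=.
  rewrite !addn0 => cT szD; rewrite -cT; split=> //; exists D => //.
  by rewrite cT.
have subr z : {subset h0 <= rcons h z}.
  by move=> p /sub0 ph; rewrite mem_rcons inE ph orbT.
have folr z : blocks_followed c (rcons h z).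
  by move=> b /folc[q qh qb]; exists q; rewrite // mem_rcons inE qh orbT.
case: ifP => turn_h.
  rewrite add1n addnS => cT; rewrite addnS addnS ltnS => szD.
  have lt_cT : (c < T)%N by rewrite -cT ltnS leq_addr.
  have [z gpz zc] := follows_block_exists gph sub0 lt_cT; exists z; split=> //.
  apply: (IHd _ c.+1 D); rewrite ?size_rcons//.
  + move=> b; rewrite ltnS leq_eqVlt => /predU1P[->|/folr//].
    by exists z; rewrite // mem_rcons mem_head.
  + move=> i w iN iD; rewrite mem_rcons inE => /predU1P[->|wh]; last exact: emptyD.
    by move=> /(follows_block_not_above zc iN).
rewrite add0n => cT szD z gpz.
have [[i [iN zi]]|noi] := pselect (exists i, (i < T * M)%N /\ above mu (P i) z).
  apply: (IHd _ c (i :: D)); rewrite ?size_rcons//; last by rewrite /= addSnnS.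
  move=> j w jN; rewrite inE negb_or => /andP[ji jD].
  rewrite mem_rcons inE => /predU1P[->|wh]; last exact: emptyD.
  by move=> /(above_inj iN jN zi)/eqP; rewrite eq_sym (negPf ji).
apply: (IHd _ c D); rewrite ?size_rcons//; last by apply: leq_trans szD; rewrite addnS.
move=> j w jN jD; rewrite mem_rcons inE => /predU1P[->|wh]; last exact: emptyD.
by move=> zj; case: noi; exists j.
Qed.

(** Each dead block uses up [M] indices of [D], so at least [t] blocks keep a chain outside [D],
    which the point following the block allows to extend. *)
Lemma phase_harvest h D : general_position h -> {subset h0 <= h} -> blocks_followed T h ->
  empty_outside D h -> (0 < M)%N -> (size D + M * t <= M * T)%N ->
  exists P' : nat -> {fset plane R}, chain_family mu k.+1 t h P'.
Proof.
move=> gph sub0 fol emptyD M0 szD; have [emptyP sortP] := familyP.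
pose dead b := all [in D] (iota (b * M) M).
pose A := [seq b <- iota 0 T | ~~ dead b].
have szA : (t <= size A)%N.
  have := count_predC dead (iota 0 T); rewrite size_filter size_iota.
  have := full_blocks_le D M T; rewrite -/dead => deadD alive_dead.
  rewrite -(leq_pmul2l M0) -(leq_add2l (size D)); apply: leq_trans szD _.
  by rewrite -[in leqLHS]alive_dead mulnDr leq_add2r.
pose blk j := nth 0%N A j.
have blk_mono i j : (i < j < t)%N -> (blk i < blk j)%N.
  move=> /andP[ij jt]; apply: (sorted_ltn_nth ltn_trans) => //; rewrite ?inE.
  - exact/sorted_filter/iota_ltn_sorted/ltn_trans.
  - exact: leq_trans (ltn_trans ij jt) szA.
  - exact: leq_trans jt szA.
(* The bounds recorded on [P'], not left of chain [i] and not right of [q], serve to order the new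
   chains; [fset0] is the default for [j >= t]. *)
have ext j : exists P' : {fset plane R}, (j < t)%N -> exists q i,
    [/\ follows_block (blk j) q, (blk j * M <= i < T * M)%N, empty_chain mu k.+1 h P',
        forall p, p \in P' -> X p <= X q &
        forall p, p \in P' -> exists2 p', p' \in P i & X p' <= X p].
  have [jt|_] := ssrnat.ltnP j t; last by exists fset0.
  have : blk j \in A by rewrite mem_nth// (leq_trans jt).
  rewrite mem_filter mem_iota /= add0n => /andP[/allPn[i + iD] bT].
  rewrite mem_iota addnC -mulSn => /andP[bi ib].
  have iN : (i < T * M)%N by rewrite (leq_trans ib)// leq_mul2r bT orbT.
  have [q qh qb] := fol _ bT; have [sep steep] := qb i iN.
  have [szi subi cci emptyi] := emptyP i iN.
  have chi : empty_chain mu k h (P i).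
    by split=> // [p /subi/sub0//|z]; exact: emptyD.
  have [|r [le_rq lt_r chr]] := extend_chain gph k_gt0 chi qh _ steep.
    by move=> p /sep; rewrite ib.
  have [p0 p0i] : exists p, p \in P i by apply/fset0Pn; rewrite -cardfs_gt0 szi.
  exists (r |` P i)%fset => _; exists q, i; split=> //; first by rewrite bi.
  - by move=> p; rewrite in_fset1U => /predU1P[->//|/sep]; rewrite ib => /ltW.
  - move=> p; rewrite in_fset1U => /predU1P[->|pi]; last by exists p.
    by exists p0 => //; exact/ltW/lt_r.
have [P' P'P] := choice ext; exists P'; split=> [j /P'P[q [i []]]//|].
move=> i j p p' ij pi p'j; have /andP[lt_ij jt] := ij.
have [q [_ [qb _ _ le_q _]]] := P'P i (ltn_trans lt_ij jt).
have [_ [l [_ /andP[bl lN] _ _ ge_l]]] := P'P j jt.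
have [p2 p2l le_p2] := ge_l p' p'j.
(* The point [q] following block [blk i] separates: [p] is not right of it, and [p2], in a chain of
   a later block, is right of it. *)
apply: le_lt_trans (le_q p pi) (lt_le_trans _ le_p2).
have [/(_ p2 p2l) + _] := qb l lN; case: ssrnat.ltnP => // lb _.
suff : (blk j * M < (blk i).+1 * M)%N by rewrite ltn_pmul2r// ltnS leqNgt blk_mono.
exact: leq_ltn_trans bl lb.
Qed.

End Phase.

(** * Iterating the phases and counting moves *)

Section Duration.
Context {R : realType}.

(* A family of [t] chains of [k + 2] points costs a family of [4 m t] chains with
   one point less, plus [2 t] moves of Maker and [2 t m] of Breaker. *)
Fixpoint duration (m k t : nat) : nat :=
  if k is k'.+1 then (duration m k' (4 * m * t) + 2 * t * m.+1)%N else (2 * t)%N.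

(** Unrolling multiplies [t] by [4 * m] at each level, so the added terms [2 * t * m.+1] form a
    geometric sum. *)
Lemma durationE (m k t : nat) : (0 < m)%N -> (duration m k t)%:R =
  ((4 * m%:R) ^+ k + (m%:R + 1) * ((4 * m%:R) ^+ k - 1) / (4 * m%:R - 1)) * (2 * t%:R) :> R.
Proof.
move=> m0; have m1 : 1 <= m%:R :> R by rewrite ler1n.
have nz : 4 * m%:R - 1 != 0 :> R by rewrite gt_eqF//; lra.
elim: k t => [|k IHk] t /=; first by rewrite !expr0 natrM; field.
by rewrite natrD IHk !natrM -natr1 exprS; field.
Qed.

Lemma forces_chain_family (s : R) (m : nat) : 1 <= s -> s <= m%:R -> forall k t,
  exists2 n, (n <= duration m k t)%N & forces s (fun h =>
    exists mu (P : nat -> {fset plane R}), chain_family mu k.+2 t h P) n [::].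
Proof.
move=> s1 sm; have m0 : (0 < m)%N by rewrite -(ltr_nat R); lra.
have gp0 : general_position ([::] : seq (plane R)) by split.
elim=> [|k IHk] t.
  exists (2 * t)%N => //; apply: forces_always => // h gph szh.
  exact: base_chain_family.
have [n1 n1_le F1] := IHk (4 * m * t)%N.
have [d d_le turns_d] := maker_turns_window n1 (2 * t)%N s1 sm.
exists (n1 + d)%N; first exact: leq_add.
apply/forcesD/(forces_mono gp0 _ F1) => h gph szh [mu [P]].
(* [2 * t] blocks of [2 * m] chains: Breaker's [2 * t * m] kills destroy at most [t] blocks, leaving
   the [t] required. *)
have -> : (4 * m * t = 2 * t * (2 * m))%N by lia.
move=> familyP; have [emptyP _] := familyP.
have turns_h : count (maker_turn s) (iota (size h) d) = (2 * t)%N by rewrite szh.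
apply: (forces_mono gph) (@phase_forces _ s mu k.+2 m (2 * t) (2 * m) h P familyP d h 0 [::]
  gph _ _ _ _ _) => //.
- move=> h' gph' _ [sub fol [D emptyD szD]]; exists mu.
  by apply: (phase_harvest _ familyP gph' sub fol emptyD); lia.
- by move=> i z iN _; have [_ _ _] := emptyP i iN; exact.
- by rewrite turns_h /= add0n; move: d_le; lia.
Qed.

Lemma parallel_strips0 (t : nat) (h : seq (plane R)) : parallel_strips 0 t h.
Proof.
have region0 v : strip_region (fset0 : {fset plane R}) v = set0.
  apply/seteqP; split=> // z [p hp _].
  (* On the empty set even the zero form is vacuously positive, so its hull has no point. *)
  have : 0 < affine_form 0 0 0 0 p by apply: hull_affine_gt0 hp.
  by rewrite /affine_form !mul0r !addr0 ltxx.
have strip0 : k_strip [set` h] 0 (dir 0) (fset0 : {fset plane R}).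
  split; first by split=> // p.
  rewrite /boundary region0 interior0 closure0 set0D set0I; split=> //; first exact: dir_neq0.
  by apply/seteqP; split.
by exists (dir 0), (fun=> fset0); split=> // i j _; split=> //; rewrite region0 set0I.
Qed.

End Duration.

Theorem theorem4 (R : realType) (k t : nat) (s : R) (s_ge1 : 1 <= s) :
  maker_ensures s (parallel_strips k t) /\
  (s \is a Num.nat ->
    (k = 1%N ->
      maker_ensures_within s (t%:R / (s + 1)) (parallel_strips k t)) /\
    ((2 <= k)%N ->
      maker_ensures_within s
        (((4 * s) ^+ (k - 2) / (s + 1) +
          ((4 * s) ^+ (k - 2) - 1) / (4 * s - 1)) * (2 * t%:R))
        (parallel_strips k t))).
Proof.
have gp0 : general_position ([::] : seq (plane R)) by split.
have chain_forces k' n : (0 < k')%N ->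
    forces s (fun h => exists mu (P : nat -> {fset plane R}), chain_family mu k' t h P) n [::] ->
    forces s (parallel_strips k' t) n [::].
  move=> k'0; apply: forces_mono => // h _ _ [mu [P]]; exact: chain_family_parallel.
have forces1 : forces s (parallel_strips 1 t) t [::].
  apply: chain_forces => //; apply: forces_always => // h gph szh.
  by apply: base_chain_family; rewrite // mul1n.
have forces2 (m j : nat) : s <= m%:R ->
    exists2 n, (n <= duration m j t)%N & forces s (parallel_strips j.+2 t) n [::].
  move=> sm; have [n n_le F] := forces_chain_family s_ge1 sm j t; exists n => //.
  exact: chain_forces.
have ensures goal n : forces s goal n [::] -> maker_ensures s goal.
  move=> /forces_strategy[sigma [strat win]]; exists sigma; split=> // x lx fx.
  by exists n; exact: win.
have within goal n r : n%:R / (s + 1) <= r -> forces s goal n [::] ->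
    maker_ensures_within s r goal.
  move=> nr F; apply: (ensures _ n); apply: forces_mono F => // h _ szh gh.
  by rewrite /rounds szh.
split.
  case: k => [|[|j]]; first by apply: (ensures _ 0%N); exact: parallel_strips0.
    exact: ensures forces1.
  (* For arbitrary [s] any integer bound on the speed serves as [m]; for integer [s], below, [m] is
     [s] itself, which gives the stated count. *)
  have [|n _] := forces2 (Num.bound s) j; last exact: ensures.
  by apply/ltW/archi_boundP; lra.
move=> /natrP[m sE]; split=> [->|]; first exact: within forces1.
case: k => [|[|j]]// _; rewrite subSS subSS subn0.
have m0 : (0 < m)%N by rewrite -(ltr_nat R) -sE; lra.
have [|n n_le] := forces2 m j; first by rewrite sE.
apply: within; apply: (@le_trans _ _ ((duration m j t)%:R / (s + 1))).
  by rewrite ler_pM2r ?invr_gt0 ?ler_nat//; lra.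
rewrite durationE// -sE le_eqVlt; apply/orP; left; apply/eqP; field.
by rewrite !gt_eqF//; lra.
Qed.
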